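(* (Canonicity) In the Fitch-style calculus for $IK$: let $\Gamma$ be a context containing no variable assignments (i.e. consisting only of locks), suppose $\Gamma\vdash t:A$ is derivable and $t$ is normal. Then the outermost term former of $t$ is the introduction form for the main type former of $A$.
   Context: Types: $A,B ::= p \mid 1 \mid A\times B \mid A\to B \mid 0 \mid A+B \mid \Box A$ ($p$ atoms; there are no term constants). Contexts: $\Gamma ::= \cdot \mid \Gamma,x:A \mid \Gamma,\bullet$ (variables distinct; $\bullet$ is a structural symbol called a lock). Terms: $x$, $\langle\rangle$, $\langle t,u\rangle$, $\pi_1 t$, $\pi_2 t$, $\lambda x.t$, $t\,u$, $\mathrm{inl}\,t$, $\mathrm{inr}\,t$, $\mathrm{case}\ s\ \mathrm{of}\ (x.t;\,y.u)$, $\mathrm{abort}\,t$, $\mathrm{shut}\,t$, $\mathrm{open}\,t$. Introduction forms: $\langle\rangle$ for $1$, $\langle t,u\rangle$ for $\times$, $\lambda x.t$ for $\to$, $\mathrm{inl}\,t$/$\mathrm{inr}\,t$ for $+$, $\mathrm{shut}\,t$ for $\Box$; atoms and $0$ have no introduction form. Typing rules: (var) $\Gamma,x:A,\Gamma'\vdash x:A$ provided $\Gamma'$ contains no lock; (products) $\Gamma\vdash\langle\rangle:1$; from $\Gamma\vdash t:A$, $\Gamma\vdash u:B$ infer $\Gamma\vdash\langle t,u\rangle:A\times B$; from $\Gamma\vdash t:A_1\times A_2$ infer $\Gamma\vdash\pi_i t:A_i$; (functions) from $\Gamma,x:A\vdash t:B$ infer $\Gamma\vdash\lambda x.t:A\to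 B$; from $\Gamma\vdash t:A\to B$, $\Gamma\vdash u:A$ infer $\Gamma\vdash t\,u:B$; (sums) from $\Gamma\vdash t:A$ infer $\Gamma\vdash\mathrm{inl}\,t:A+B$; symmetrically for $\mathrm{inr}$; from $\Gamma\vdash s:A+B$, $\Gamma,x:A,\Gamma'\vdash t:C$, $\Gamma,y:B,\Gamma'\vdash u:C$ infer $\Gamma,\Gamma'\vdash\mathrm{case}\ s\ \mathrm{of}\ (x.t;\,y.u):C$ (any $\Gamma'$); from $\Gamma\vdash t:0$ infer $\Gamma,\Gamma'\vdash\mathrm{abort}\,t:A$ (any $\Gamma'$); (shut) from $\Gamma,\bullet\vdash t:A$ infer $\Gamma\vdash\mathrm{shut}\,t:\Box A$; (open) from $\Gamma\vdash t:\Box A$ infer $\Gamma,\bullet,\Gamma'\vdash\mathrm{open}\,t:A$ provided $\Gamma'$ contains no lock. Reduction: $\mapsto$ is the closure under all term formers of $(\lambda x.t)\,u\mapsto t[u/x]$; $\pi_i\langle t_1,t_2\rangle\mapsto t_i$; $\mathrm{case}\ (\mathrm{inl}\,s)\ \mathrm{of}\ (x.t;\,y.u)\mapsto t[s/x]$; $\mathrm{case}\ (\mathrm{inr}\,s)\ \mathrm{of}\ (x.t;\,y.u)\mapsto u[s/y]$; $\mathrm{open}\,\mathrm{shut}\,t\mapsto t$; and the commuting conversions $E[\mathrm{case}\ s\ \mathrm{of}\ (x.t;\,y.u)]\mapsto\mathrm{case}\ s\ \mathrm{of}\ (x.E[t];\,y.E[u])$ and $E[\mathrm{abort}\,t]\mapsto\mathrm{abort}\,t$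 for every elimination frame $E[-]$ among $[-]\,v$, $\pi_1[-]$, $\pi_2[-]$, $\mathrm{case}\ [-]\ \mathrm{of}\ (\ldots)$, $\mathrm{abort}[-]$, $\mathrm{open}[-]$. A term is normal if it admits no reduction step $\mapsto$. *)

(* Defs.v *)
(* Stdlib world. *)
From Stdlib Require Import List Arith Lia.
Import ListNotations.

Inductive ty : Type :=
| TAtom (p : nat)
| TOne
| TProd (A B : ty)
| TArr (A B : ty)
| TZero
| TSum (A B : ty)
| TBox (A : ty).

(* Terms up to renaming of bound variables, in locally nameless style: free
   variables are names (as in contexts), bound variables are de Bruijn indices.
   [Lam t] binds index 0 in [t]; [Case s t u] binds index 0 in [t] and in [u].
   Names rather than indices for free variables matter here: the rules for
   [Case], [Abort] and [Open] reuse a term of the context G, unchanged, in a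
   larger context G, G'. *)
Inductive tm : Type :=
| BVar (i : nat)
| FVar (x : nat)
| Unit
| Pair (t u : tm)
| Fst (t : tm)
| Snd (t : tm)
| Lam (t : tm)
| App (t u : tm)
| Inl (t : tm)
| Inr (t : tm)
| Case (s t u : tm)
| Abort (t : tm)
| Shut (t : tm)
| Open (t : tm).

Fixpoint fv (t : tm) : list nat :=
  match t with
  | BVar _ | Unit => []
  | FVar x => [x]
  | Pair t u | App t u => fv t ++ fv u
  | Fst t | Snd t | Lam t | Inl t | Inr t | Abort t | Shut t | Open t => fv t
  | Case s t u => fv s ++ fv t ++ fv u
  end.

(* No shifting of [v] under binders: [v] is meant to be locally closed. *)
Fixpoint inst_at (k : nat) (v t : tm) : tm :=
  match t with
  | BVar i => if i =? k then v else BVar i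
  | FVar x => FVar x
  | Unit => Unit
  | Pair t u => Pair (inst_at k v t) (inst_at k v u)
  | Fst t => Fst (inst_at k v t)
  | Snd t => Snd (inst_at k v t)
  | Lam t => Lam (inst_at (S k) v t)
  | App t u => App (inst_at k v t) (inst_at k v u)
  | Inl t => Inl (inst_at k v t)
  | Inr t => Inr (inst_at k v t)
  | Case s t u => Case (inst_at k v s) (inst_at (S k) v t) (inst_at (S k) v u)
  | Abort t => Abort (inst_at k v t)
  | Shut t => Shut (inst_at k v t)
  | Open t => Open (inst_at k v t)
  end.

(* [inst v t] is t[v/x], where x is the variable bound by the binder directly
   above [t]; [inst (FVar x) t] names that variable x. *)
Definition inst (v t : tm) : tm := inst_at 0 v t.

Inductive entry : Type :=
| EVar (x : nat) (A : ty)
| ELock.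

(* The head of the list is the rightmost entry, so G, x:A, G' is
   [G' ++ EVar x A :: G]. *)
Definition ctx : Type := list entry.

Definition lock_free (G : ctx) : Prop := ~ In ELock G.

Definition no_vars (G : ctx) : Prop := forall x A, ~ In (EVar x A) G.

Fixpoint names (G : ctx) : list nat :=
  match G with
  | [] => []
  | EVar x _ :: G => x :: names G
  | ELock :: G => names G
  end.

Definition distinct (G : ctx) : Prop := NoDup (names G).

(* The premises [distinct _] occur exactly in the rules whose conclusion has a
   context not already covered by a premise; see [typing_distinct].  The rules
   with binders name the bound variable by some x not free in the body. *)
Inductive typing : ctx -> tm -> ty -> Prop :=
| ty_var G G' x A :
    distinct (G' ++ EVar x A :: G) -> lock_free G' ->
    typing (G' ++ EVar x A :: G) (FVar x) A
| ty_unit G :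
    distinct G -> typing G Unit TOne
| ty_pair G t u A B :
    typing G t A -> typing G u B -> typing G (Pair t u) (TProd A B)
| ty_fst G t A B :
    typing G t (TProd A B) -> typing G (Fst t) A
| ty_snd G t A B :
    typing G t (TProd A B) -> typing G (Snd t) B
| ty_lam G x t A B :
    ~ In x (fv t) ->
    typing (EVar x A :: G) (inst (FVar x) t) B ->
    typing G (Lam t) (TArr A B)
| ty_app G t u A B :
    typing G t (TArr A B) -> typing G u A -> typing G (App t u) B
| ty_inl G t A B :
    typing G t A -> typing G (Inl t) (TSum A B)
| ty_inr G t A B :
    typing G t B -> typing G (Inr t) (TSum A B)
| ty_case G G' x y s t u A B C :
    typing G s (TSum A B) ->
    ~ In x (fv t) ->
    typing (G' ++ EVar x A :: G) (inst (FVar x) t) C ->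
    ~ In y (fv u) ->
    typing (G' ++ EVar y B :: G) (inst (FVar y) u) C ->
    typing (G' ++ G) (Case s t u) C
| ty_abort G G' t A :
    distinct (G' ++ G) ->
    typing G t TZero -> typing (G' ++ G) (Abort t) A
| ty_shut G t A :
    typing (ELock :: G) t A -> typing G (Shut t) (TBox A)
| ty_open G G' t A :
    distinct (G' ++ ELock :: G) -> lock_free G' ->
    typing G t (TBox A) -> typing (G' ++ ELock :: G) (Open t) A.

Inductive frame : Type :=
| FApp (v : tm)
| FFst
| FSnd
| FCase (t u : tm)
| FAbort
| FOpen.

Definition plug (E : frame) (s : tm) : tm :=
  match E with
  | FApp v => App s v
  | FFst => Fst s
  | FSnd => Snd s
  | FCase t u => Case s t u
  | FAbort => Abort s
  | FOpen => Open s
  end.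

(* One-step reduction of locally closed terms.  In [st_comm_case] the terms
   inside [E] have no dangling indices, so moving [E] under the binders of
   [Case] cannot capture.  The congruence rules under a binder name the bound
   variable by some x free in neither body. *)
Inductive step : tm -> tm -> Prop :=
| st_beta t u : step (App (Lam t) u) (inst u t)
| st_fst t u : step (Fst (Pair t u)) t
| st_snd t u : step (Snd (Pair t u)) u
| st_case_inl s t u : step (Case (Inl s) t u) (inst s t)
| st_case_inr s t u : step (Case (Inr s) t u) (inst s u)
| st_open_shut t : step (Open (Shut t)) t
| st_comm_case E s t u :
    step (plug E (Case s t u)) (Case s (plug E t) (plug E u))
| st_comm_abort E t : step (plug E (Abort t)) (Abort t)
| st_pair_l t t' u : step t t' -> step (Pair t u) (Pair t' u)
| st_pair_r t u u' : step u u' -> step (Pair t u) (Pair t u')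
| st_fst_c t t' : step t t' -> step (Fst t) (Fst t')
| st_snd_c t t' : step t t' -> step (Snd t) (Snd t')
| st_lam x t t' :
    ~ In x (fv t) -> ~ In x (fv t') ->
    step (inst (FVar x) t) (inst (FVar x) t') -> step (Lam t) (Lam t')
| st_app_l t t' u : step t t' -> step (App t u) (App t' u)
| st_app_r t u u' : step u u' -> step (App t u) (App t u')
| st_inl t t' : step t t' -> step (Inl t) (Inl t')
| st_inr t t' : step t t' -> step (Inr t) (Inr t')
| st_case_s s s' t u : step s s' -> step (Case s t u) (Case s' t u)
| st_case_t x s t t' u :
    ~ In x (fv t) -> ~ In x (fv t') ->
    step (inst (FVar x) t) (inst (FVar x) t') ->
    step (Case s t u) (Case s t' u)
| st_case_u y s t u u' :
    ~ In y (fv u) -> ~ In y (fv u') ->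
    step (inst (FVar y) u) (inst (FVar y) u') ->
    step (Case s t u) (Case s t u')
| st_abort t t' : step t t' -> step (Abort t) (Abort t')
| st_shut t t' : step t t' -> step (Shut t) (Shut t')
| st_open t t' : step t t' -> step (Open t) (Open t').

Definition normal (t : tm) : Prop := ~ exists t', step t t'.

(* No clause for [TAtom] and [TZero], which have no introduction form. *)
Inductive intro_form : ty -> tm -> Prop :=
| intro_one : intro_form TOne Unit
| intro_prod A B t u : intro_form (TProd A B) (Pair t u)
| intro_arr A B t : intro_form (TArr A B) (Lam t)
| intro_inl A B t : intro_form (TSum A B) (Inl t)
| intro_inr A B t : intro_form (TSum A B) (Inr t)
| intro_box A t : intro_form (TBox A) (Shut t).

Fixpoint closed_at (k : nat) (t : tm) : Prop :=
  match t with
  | BVar i => i < k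
  | FVar _ | Unit => True
  | Pair t u | App t u => closed_at k t /\ closed_at k u
  | Fst t | Snd t | Inl t | Inr t | Abort t | Shut t | Open t => closed_at k t
  | Lam t => closed_at (S k) t
  | Case s t u => closed_at k s /\ closed_at (S k) t /\ closed_at (S k) u
  end.

Lemma closed_inst k x t :
  closed_at k (inst_at k (FVar x) t) -> closed_at (S k) t.
Proof.
  revert k; induction t; simpl; intros k H; intuition auto.
  destruct (Nat.eqb_spec i k); simpl in *; lia.
Qed.

Lemma typing_closed G t A : typing G t A -> closed_at 0 t.
Proof.
  induction 1; simpl; eauto; repeat split; eauto using closed_inst.
Qed.

Lemma names_app G' G : names (G' ++ G) = names G' ++ names G.
Proof.
  induction G' as [|[x A|] G' IH]; simpl; congruence.
Qed.

Lemma typing_distinct G t A : typing G t A -> distinct G.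
Proof.
  unfold distinct; induction 1; auto.
  - now inversion IHtyping.
  - rewrite names_app in *; simpl in *; eauto using NoDup_remove_1.
Qed.

(* Main.v *)
(* By induction on the typing derivation: the scrutinee of an elimination in a
   variable-free context is typed in a prefix of that context, which is again
   variable-free, so by induction it is an introduction form and the
   elimination is a redex (or the scrutinee has type 0, which has no
   introduction form).  Hence the term is not an elimination, and it is not a
   variable. *)
From Stdlib Require Import List.
Require Import Defs.

Lemma no_vars_app (G' G : ctx) : no_vars (G' ++ G) -> no_vars G.
Proof.
  intros H x A Hin; apply (H x A), in_or_app; auto.
Qed.

Lemma no_vars_lock (G : ctx) : no_vars (ELock :: G) -> no_vars G.
Proof. exact (no_vars_app (ELock :: nil) G). Qed.

(** Reduction is closed under elimination frames, so a step of [s] would lift to [plug E s]. *)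
Lemma normal_scrutinee (E : frame) (s : tm) : normal (plug E s) -> normal s.
Proof.
  intros H [s' Hs]; apply H; exists (plug E s').
  destruct E; simpl; eauto using st_app_l, st_fst_c, st_snd_c, st_case_s, st_abort, st_open.
Qed.

Theorem theorem4 (G : ctx) (t : tm) (A : ty)
  (hG : no_vars G) (ht : typing G t A) (hn : normal t) :
  intro_form A t.
Proof.
  (* [hG] and [hn] depend on the indices of [ht], so they are generalised and become premises of
     each [IH]. [constructor] settles the introduction rules. *)
  induction ht as [G G' x A _ _ | | | G t A B _ IH | G t A B _ IH |
    | G t u A B _ IH _ _ | |
    | G G' x y s t u A B C _ IH _ _ _ _ _ _ | G G' t A _ _ IH |
    | G G' t A _ _ _ IH]; try constructor.
  - exfalso; apply (hG x A), in_elt.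
  - specialize (IH hG (normal_scrutinee FFst t hn)).
    inversion IH; subst; destruct hn; eauto using step.
  - specialize (IH hG (normal_scrutinee FSnd t hn)).
    inversion IH; subst; destruct hn; eauto using step.
  - specialize (IH hG (normal_scrutinee (FApp u) t hn)).
    inversion IH; subst; destruct hn; eauto using step.
  - specialize (IH (no_vars_app _ _ hG) (normal_scrutinee (FCase t u) s hn)).
    inversion IH; subst; destruct hn; eauto using step.
  - specialize (IH (no_vars_app _ _ hG) (normal_scrutinee FAbort t hn)).
    inversion IH.
  (* The scrutinee of [Open] is typed to the left of the lock: drop [G'], then the lock itself. *)
  - specialize (IH (no_vars_lock _ (no_vars_app _ _ hG))
                   (normal_scrutinee FOpen t hn)).
    inversion IH; subst; destruct hn; eauto using step.
Qed.
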